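(* Consider a finite MDP $\langle\mathcal S,\mathcal A,(\mathcal A(s),s\in\mathcal S),P,r\rangle$ (with $r$ interpreted as a cost), a horizon $T\ge1$ and $\alpha\in(0,1]$. Given a policy $u\in\mathcal U^{\rm DH}$, for $s_0\in\mathcal S$ let $\mathrm{VaR}^u_-(s_0,\Lambda_0)$ be the left predecessor of $\mathrm{VaR}^u(s_0)$ in $\Lambda_0$. (a) For $s_0\in\mathcal S$, if there exists another policy $u'\in\mathcal U^{\rm DH}$ such that $F^{u'}(s_0,\mathrm{VaR}^u_-(s_0,\Lambda_0))\ge\alpha$, then $\mathrm{VaR}^{u'}(s_0)<\mathrm{VaR}^u(s_0)$. (b) The policy $u$ is optimal for the finite-horizon VaR minimization MDP, i.e. $\mathrm{VaR}^u(s_0)=\inf_{v\in\mathcal U^{\rm RH}}\mathrm{VaR}^v(s_0)$ for all $s_0\in\mathcal S$, if and only if $F^*(s_0,\mathrm{VaR}^u_-(s_0,\Lambda_0))<\alpha$ for every $s_0\in\mathcal S$, where $F^*(s_0,\lambda_0):=\sup_{v\in\mathcal U^{\rm RH}}F^v(s_0,\lambda_0)$.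
   Context: MDP: $\mathcal S$ and $\mathcal A$ are finite sets; $\mathcal A(s)\subseteq\mathcal A$ is the nonempty set of admissible actions in $s$, with $\cup_s\mathcal A(s)=\mathcal A$; $\mathcal K:=\{(s,a):s\in\mathcal S,a\in\mathcal A(s)\}$; $P(\cdot|s,a)$ is a probability distribution on $\mathcal S$ for each $(s,a)\in\mathcal K$; $r:\mathcal K\to\mathbb R$ is the instantaneous cost. Policies: $\mathcal U^{\rm RH}$ is the set of randomized history-dependent policies $u=(u_t)_{t}$, where $u_t(\cdot|h_t)$ is a probability distribution on $\mathcal A(s_t)$ for each history $h_t=(s_0,a_0,\dots,s_{t-1},a_{t-1},s_t)\in\mathcal K^t\times\mathcal S$; $\mathcal U^{\rm DH}$ is the subset of deterministic ones ($u_t(h_t)\in\mathcal A(s_t)$). $\mathbb P^u_{s_0}$ is the law of $(s_0,a_0,s_1,a_1,\dots)$ under $u$ started from $s_0$. Finite-horizon quantities: $R_{0:T}:=\sum_{t=0}^{T-1}r(s_t,a_t)$ (the terminal cost is zero); $\Lambda_0:=\{\sum_{t=0}^{T-1}r(s_t,a_t):(s_t,a_t)\in\mathcal K\text{ for all }t\}$; $F^u(s_0,\lambda_0):=\mathbb P^u_{s_0}(R_{0:T}\le\lambda_0)$ for $\lambda_0\in\mathbb R$; $\mathrm{VaR}^u(s_0):=\inf\{\lambda\in\mathbb R:F^u(s_0,\lambda)\ge\alpha\}$. Left predecessor of $\lambda\in\mathbb R$ in the finite set $\Lambda_0$: $\max\{y\in\Lambda_0:y<\lambda\}$ if $\lambda>\min\Lambda_0$,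 and $\lambda-1$ if $\lambda\le\min\Lambda_0$. *)

(* Defs.v *)
From HB Require Import structures.
From mathcomp Require Import all_boot all_order all_algebra.
From mathcomp Require Import all_classical all_reals.

Set Implicit Arguments.
Unset Strict Implicit.
Unset Printing Implicit Defensive.

Import Order.TTheory GRing.Theory Num.Theory.
Local Open Scope classical_set_scope.
Local Open Scope ring_scope.

Record mdp (R : realType) (S A : finType) := MDP {
  adm : S -> {set A};
  adm_nonempty : forall s, exists a, a \in adm s;
  adm_cover : forall a, exists s, a \in adm s;
  trans : {k : S * A | k.2 \in adm k.1} -> S -> R;
  trans_ge0 : forall k s, 0 <= trans k s;
  trans_sum1 : forall k, \sum_s trans k s = 1;
  cost : {k : S * A | k.2 \in adm k.1} -> R
}.

(* The set of admissible state-action pairs. *)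
Notation K M := {k : _ * _ | k.2 \in adm M k.1}.

Section Mdp.
Variables (R : realType) (S A : finType) (M : mdp R S A).

Definition st (k : K M) : S := (val k).1.
Definition ac (k : K M) : A := (val k).2.

(* A history (s_0,a_0,...,s_(t-1),a_(t-1),s_t) is given by the sequence h of
   its first t state-action pairs and by s = s_t.  As [seq (K M)] is the
   disjoint union of the K^t, the single function u encodes the whole family
   (u_t)_t, with u_t(a | h, s) = u h s a for t = size h. *)
Definition policy := seq (K M) -> S -> A -> R.

Definition RH : set policy := [set u | forall h s,
  [/\ forall a, 0 <= u h s a,
      forall a, a \notin adm M s -> u h s a = 0 &
      \sum_a u h s a = 1]].

(* Deterministic policies, seen as Dirac-valued randomized ones. *)
Definition DH : set policy := [set u | exists d : seq (K M) -> S -> A,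
  forall h s, d h s \in adm M s /\ forall a, u h s a = (a == d h s)%:R].

Lemma DH_sub_RH : DH `<=` RH.
Proof.
move=> u [d ud] h s; have [ds {}ud] := ud h s; split=> [a|a as_|].
- by rewrite ud ler0n.
- by rewrite ud; case: eqP => // ad; rewrite ad ds in as_.
- rewrite (bigD1 (d h s)) //= ud eqxx big1 ?addr0// => a /negbTE ad.
  by rewrite ud ad.
Qed.

(* Probability that s_t = s given s_0 and the first t state-action pairs h. *)
Definition next_prob (s0 : S) (h : seq (K M)) (s : S) : R :=
  if h is k :: h' then trans (last k h') s else (s == s0)%:R.

Variable T : nat.

(* Law of (s_0,a_0,...,s_(T-1),a_(T-1)) under u started from s0; this marginal
   of the law of the infinite trajectory determines the law of the total cost
   up to the horizon T. *)
Definition law (u : policy) (s0 : S) (w : T.-tuple (K M)) : R :=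
  \prod_(t < T) (next_prob s0 (take t w) (st (tnth w t)) *
                 u (take t w) (st (tnth w t)) (ac (tnth w t))).

Definition total_cost (w : T.-tuple (K M)) : R :=
  \sum_(t < T) cost (tnth w t).

Definition Lambda0 : set R := range total_cost.

Definition F (u : policy) (s0 : S) (lam : R) : R :=
  \sum_(w : T.-tuple (K M) | total_cost w <= lam) law u s0 w.

Definition Fstar (s0 : S) (lam : R) : R := sup [set F v s0 lam | v in RH].

Definition VaR (alpha : R) (u : policy) (s0 : S) : R :=
  inf [set lam | alpha <= F u s0 lam].

End Mdp.

Section LeftPredecessor.
Variable R : realType.
Implicit Types L : set R.

Definition max_of L : R := xget 0 (L `&` ubound L).
Definition min_of L : R := xget 0 (L `&` lbound L).

Definition left_pred L (lam : R) : R :=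
  if min_of L < lam then max_of (L `&` [set y | y < lam]) else lam - 1.

End LeftPredecessor.

Definition VaR_minus (R : realType) (S A : finType) (M : mdp R S A) (T : nat)
    (alpha : R) (u : policy M) (s0 : S) : R :=
  left_pred (Lambda0 M T) (VaR T alpha u s0).

(* Main.v *)
(* Every attainable total cost lies in the finite set Lambda0, so VaR^v is an
   element of Lambda0 and F^v(lam) >= alpha iff VaR^v <= lam.  Hence v strictly
   improves on u iff F^v reaches alpha at the left predecessor of VaR^u.  To get
   the strict inequality F* < alpha from F^v < alpha for all v, the supremum F*
   must be attained: F^v(lam) is the expectation of an indicator of the history
   up to T, which backward induction over histories maximizes. *)
Require Import Defs.
From mathcomp Require Import all_boot all_order all_algebra.
From mathcomp Require Import all_classical all_reals.

Import Order.TTheory GRing.Theory Num.Theory.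
Local Open Scope classical_set_scope.
Local Open Scope ring_scope.

Set Implicit Arguments.
Unset Strict Implicit.
Unset Printing Implicit Defensive.

Lemma big_tuple_cons (V : nmodType) (I : finType) n (G : n.+1.-tuple I -> V) :
  \sum_(w : n.+1.-tuple I) G w =
  \sum_(i : I) \sum_(w : n.-tuple I) G (cons_tuple i w).
Proof.
rewrite pair_big_dep /= (reindex (fun p => cons_tuple p.1 p.2)) //=.
exists (fun w => (thead w, behead_tuple w)) => [[i w] _|w _] /=.
  by congr pair; apply/val_inj.
by apply/val_inj; case/tupleP: w.
Qed.

(** * Predecessors and quantiles in a finite set of reals *)

Section FiniteRange.
Variables (R : realType) (I : finType) (c : I -> R) (i0 : I).

Lemma min_of_range : exists2 i, min_of (range c) = c i & forall j, c i <= c j.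
Proof.
have : exists x, (range c `&` lbound (range c)) x.
  have [i _ le_i] := @Order.TotalTheory.arg_minP _ _ _ i0 predT c isT.
  by exists (c i); split=> [|_ [j _ <-]]; [exists i | exact: le_i].
move=> /(xgetPex 0)[[i _ ci] lb]; exists i => [|j]; first exact/esym.
by rewrite ci; apply: lb; exists j.
Qed.

(** A finite nonempty set has a maximum, so [xget] does not fall back on its default [0]. *)
Lemma max_of_range_lt (lam : R) i (L := range c `&` [set y | y < lam]) :
  c i < lam -> (L `&` ubound L) (max_of L).
Proof.
move=> lt_i; rewrite /max_of; apply: xgetPex.
have [j lt_j le_j] :=
  @Order.TotalTheory.arg_maxP _ _ _ i (fun i => c i < lam) c lt_i.
exists (c j); split=> [|_ [[k _ <-] lt_k]]; last exact: le_j.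
by split=> //; exists j.
Qed.

Lemma left_pred_lt (lam : R) : left_pred (range c) lam < lam.
Proof.
rewrite /left_pred; case: ifPn => [|_]; last by rewrite ltrBlDr ltrDl.
have [i -> _] := min_of_range => lt_i.
by have [[]] := max_of_range_lt lt_i.
Qed.

Lemma le_left_pred (lam : R) i : c i < lam -> c i <= left_pred (range c) lam.
Proof.
move=> lt_i; rewrite /left_pred; case: ifPn => [_|]; last first.
  (* In this branch [lam] is at most the minimum, against [c i < lam]. *)
  have [j -> le_j] := min_of_range.
  by rewrite (le_lt_trans (le_j i) lt_i).
by have [_] := max_of_range_lt lt_i; apply; split=> //; exists i.
Qed.

Variables (p : I -> R) (alpha : R).
Hypotheses (p_ge0 : forall i, 0 <= p i) (p_sum1 : \sum_i p i = 1).
Hypotheses (alpha_gt0 : 0 < alpha) (alpha_le1 : alpha <= 1).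

Let cdf lam : R := \sum_(i | c i <= lam) p i.

Lemma le_cdf x y : x <= y -> cdf x <= cdf y.
Proof.
move=> le_xy; rewrite /cdf big_mkcond [leRHS]big_mkcond; apply: ler_sum => i _.
by case: ifPn => [/le_trans-/(_ _ le_xy)-> //|_]; case: ifP.
Qed.

(** [cdf] is a step function that jumps only at values of [c], so the infimum is attained at the
    least value where [cdf] reaches [alpha]; the largest value of [c] is a candidate because
    [alpha <= 1]. *)
Lemma quantile_range : exists2 i, inf [set lam | alpha <= cdf lam] = c i &
  forall lam, (alpha <= cdf lam) = (c i <= lam).
Proof.
have [imax _ le_imax] := @Order.TotalTheory.arg_maxP _ _ _ i0 predT c isT.
have cdf_max : alpha <= cdf (c imax).
  by rewrite /cdf (eq_bigl predT) ?p_sum1// => i; exact: le_imax.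
have [i ai min_i] := @Order.TotalTheory.arg_minP _ _ _ imax
  (fun i => alpha <= cdf (c i)) c cdf_max.
have cdfE lam : (alpha <= cdf lam) = (c i <= lam).
  apply/idP/idP=> [a_lam|/le_cdf]; last exact: le_trans.
  (* Below all values [cdf] vanishes, which [0 < alpha] excludes. Otherwise rounding [lam] down to
     the greatest value [c k <= lam] leaves [cdf] unchanged. *)
  have [j le_j|none] := pickP (fun j => c j <= lam); last first.
    by move: a_lam; rewrite /cdf big_pred0// leNgt alpha_gt0.
  have [k le_k max_k] :=
    @Order.TotalTheory.arg_maxP _ _ _ j (fun i => c i <= lam) c le_j.
  apply: le_trans (le_k); apply: min_i.
  rewrite /cdf (eq_bigl (fun i => c i <= lam)) //.
  by move=> l; apply/idP/idP=> [/le_trans->//|]; exact: max_k.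
exists i => //; apply/eqP; rewrite eq_le; apply/andP; split.
  by apply: ge_inf => //; exists (c i) => x /=; rewrite cdfE.
by apply: lb_le_inf => [|x /=]; [exists (c i) | rewrite cdfE].
Qed.

End FiniteRange.

(** * Backward induction over histories *)

Section Paths.
Variables (R : realType) (S A : finType) (M : mdp R S A).
Implicit Types (u v : policy M) (h : seq (K M)).

Lemma sum_st_ac (f : S -> A -> R) :
  (forall s a, a \notin adm M s -> f s a = 0) ->
  \sum_(k : K M) f (st k) (ac k) = \sum_s \sum_a f s a.
Proof.
move=> f0; rewrite pair_big /= [RHS](bigID (fun x => x.2 \in adm M x.1)) /=.
rewrite [X in _ + X]big1 ?addr0 => [|x /f0//].
rewrite (reindex_omap (val : K M -> S * A) insub) /=.
  by apply: eq_bigl => k; rewrite valK eqxx (valP k).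
by move=> x Px; rewrite insubT.
Qed.

Lemma next_prob_ge0 (s0 : S) h s : 0 <= next_prob s0 h s.
Proof. by case: h => [|k h] /=; rewrite ?ler0n ?trans_ge0. Qed.

Lemma next_prob_sum1 (s0 : S) h : \sum_s next_prob s0 h s = 1.
Proof.
case: h => [|k h] /=; last exact: trans_sum1.
by rewrite (bigD1 s0)//= eqxx big1 ?addr0// => s /negbTE->.
Qed.

Definition step u s0 h (k : K M) : R :=
  next_prob s0 h (st k) * u h (st k) (ac k).

Lemma step_ge0 u s0 h k : RH u -> 0 <= step u s0 h k.
Proof. by move=> /(_ h (st k))[u0 _ _]; rewrite mulr_ge0 ?next_prob_ge0. Qed.

(** The action integrates out against a weight depending on the state alone, so the result is the
    same for all policies. *)
Lemma sum_step u s0 h (B : S -> R) : RH u ->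
  \sum_k step u s0 h k * B (st k) = \sum_s next_prob s0 h s * B s.
Proof.
move=> uRH; rewrite (sum_st_ac
  (f := fun s a => next_prob s0 h s * u h s a * B s)).
  apply: eq_bigr => s _; have [_ _ u1] := uRH h s.
  by rewrite -mulr_suml -mulr_sumr u1 mulr1.
by move=> s a na; have [_ -> //] := uRH h s; rewrite mulr0 mul0r.
Qed.

Lemma law_ge0 n u s0 (w : n.-tuple (K M)) : RH u -> 0 <= law u s0 w.
Proof. by move=> uRH; apply: prodr_ge0 => t _; exact: step_ge0. Qed.

Variable g : seq (K M) -> R.

(** Conditional expectation, given [h], of [g] at the history reached after [n] more steps. *)
Fixpoint value u s0 n h : R :=
  if n is n'.+1 then \sum_k step u s0 h k * value u s0 n' (rcons h k) else g h.

(** Letting [h] vary allows the induction to move the first pair of the tuple into the history. *)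
Lemma value_law_from u s0 n h :
  \sum_(w : n.-tuple (K M))
    (\prod_(t < n) step u s0 (h ++ take t w) (tnth w t)) * g (h ++ w) =
  value u s0 n h.
Proof.
elim: n h => [|n IHn] h.
  rewrite (big_pred1 [tuple]) => [|w]; last first.
    by apply/esym/eqP; exact: tuple0.
  by rewrite big_ord0 mul1r cats0.
rewrite big_tuple_cons /=; apply: eq_bigr => k _; rewrite -IHn mulr_sumr.
apply: eq_bigr => w _; rewrite big_ord_recl /= cats0 -mulrA cat_rcons.
congr (_ * (_ * _)); apply: eq_bigr => t _.
by rewrite tnthS /= cat_rcons.
Qed.

Lemma value_law u s0 n :
  \sum_(w : n.-tuple (K M)) law u s0 w * g w = value u s0 n [::].
Proof. by rewrite -value_law_from. Qed.

(** Choosing a pair instead of an action keeps admissibility in the type; the pairs over a given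
    state form a finite nonempty set. *)
Lemma best_pair : exists m : (K M -> R) -> S -> K M,
  forall f s, st (m f s) = s /\ forall k, st k = s -> f k <= f (m f s).
Proof.
have /choice[m mP] : forall x : (K M -> R) * S, exists k : K M,
    st k = x.2 /\ forall k', st k' = x.2 -> x.1 k' <= x.1 k.
  move=> [f s] /=; have [a as_] := adm_nonempty M s.
  pose k0 : K M := exist _ (s, a) as_.
  have [k /eqP ks max_k] :=
    @Order.TotalTheory.arg_maxP _ _ _ k0 (fun k => st k == s) f (eqxx s).
  by exists k; split=> // k' /eqP; exact: max_k.
by exists (fun f s => m (f, s)) => f s; exact: mP.
Qed.

(* The maximizer is the policy greedy for the Bellman recursion W; the number
   of remaining steps is recovered from the history h as n - size h. *)
Lemma value_max s0 n : exists2 v, RH v & forall u, RH u ->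
  value u s0 n [::] <= value v s0 n [::].
Proof.
have [m mP] := best_pair.
pose W := fix W n h := if n is n'.+1 then
  \sum_s next_prob s0 h s * W n' (rcons h (m (fun k => W n' (rcons h k)) s))
  else g h.
pose d h := m (fun k => W (n - size h).-1 (rcons h k)).
pose v : policy M := fun h s a => (a == ac (d h s))%:R.
have stac k k' : st k = st k' -> ac k = ac k' -> k = k'.
  move=> es ea; apply: val_inj.
  by rewrite [LHS]surjective_pairing [RHS]surjective_pairing; congr pair.
have vRH : RH v.
  apply: DH_sub_RH; exists (fun h s => ac (d h s)) => h s; split=> //.
  by have := valP (d h s); rewrite -/(st _) (mP _ _).1.
have v_opt l h : (size h + l = n)%N -> value v s0 l h = W l h.
  elim: l h => [//|l IHl] h hl /=.
  rewrite -(sum_step _ _ _ vRH); apply: eq_bigr => k _.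
  rewrite IHl ?size_rcons ?addSnnS//.
  (* With [l.+1] steps left, [(n - size h).-1] is [l], so [d h] maximizes the same continuation as
     [W]. *)
  have -> : m (fun k0 => W l (rcons h k0)) (st k) = d h (st k).
    by rewrite /d -hl addKn.
  (* [v] gives zero weight to every pair over [st k] except [d h (st k)]. *)
  rewrite /step /v; case: eqP => [ek|_]; last by rewrite mulr0 !mul0r.
  by congr (_ * W l (rcons h _)); apply: stac => //; rewrite (mP _ _).1.
exists v => // u uRH; rewrite v_opt//.
have u_le l h : value u s0 l h <= W l h.
  elim: l h => [//|l IHl] h /=; rewrite -(sum_step _ _ _ uRH).
  apply: ler_sum => k _; apply: ler_wpM2l; first exact: step_ge0.
  apply: le_trans (IHl _) _.
  by have [_] := mP (fun k => W l (rcons h k)) (st k); exact.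
exact: u_le.
Qed.

End Paths.

(** * Distribution of the total cost *)

Section CostDistribution.
Variables (R : realType) (S A : finType) (M : mdp R S A) (T : nat).

(** The total mass is the value of the constant function 1, which each step preserves. *)
Lemma law_sum1 (u : policy M) s0 : RH u ->
  \sum_(w : T.-tuple (K M)) law u s0 w = 1.
Proof.
move=> uRH; have := value_law (fun=> 1) u s0 T.
under eq_bigr do rewrite mulr1.
move->; elim: T [::] => [//|n IHn] h /=.
under eq_bigr do rewrite IHn.
rewrite (sum_step _ _ (fun=> 1) uRH).
by under eq_bigr do rewrite mulr1; exact: next_prob_sum1.
Qed.

Lemma F_max s0 lam : exists2 v : policy M, RH v &
  forall u : policy M, RH u -> F T u s0 lam <= F T v s0 lam.
Proof.
(* This indicator reads the accumulated cost off the whole history, which turns [F] into a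
   [value]. *)
pose g h : R := ((\sum_(k <- h) @cost R S A M k <= lam)%R)%:R.
have FE (u : policy M) : F T u s0 lam = value g u s0 T [::].
  rewrite -value_law /F big_mkcond; apply: eq_bigr => w _.
  by rewrite /g big_tuple; case: ifP => _; rewrite ?mulr1 ?mulr0.
have [v vRH v_max] := value_max g s0 T.
by exists v => // u /v_max; rewrite !FE.
Qed.

Lemma Fstar_lt s0 lam alpha :
  Fstar M T s0 lam < alpha <-> forall v : policy M, RH v -> F T v s0 lam < alpha.
Proof.
have [v vRH v_max] := F_max s0 lam.
split=> [lt_a u uRH|lt_a]; last first.
  apply: le_lt_trans (lt_a v vRH).
  apply: sup_le_ub; first by exists (F T v s0 lam), v.
  by move=> _ [u uRH <-]; exact: v_max.
apply: le_lt_trans lt_a; apply: ub_le_sup; last by exists u.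
by exists (F T v s0 lam) => _ [u' uRH' <-]; exact: v_max.
Qed.

(** Provides the inhabitant that the finite-range lemmas ask for; the constant path may have
    probability zero. *)
Lemma path_of_state : S -> T.-tuple (K M).
Proof.
move=> s0; apply: (nseq_tuple T).
have /cid[a as0] := adm_nonempty M s0.
by exists (s0, a).
Qed.

Lemma VaR_range (alpha : R) (u : policy M) s0 : 0 < alpha <= 1 -> RH u ->
  exists2 w : T.-tuple (K M), VaR T alpha u s0 = total_cost w &
  forall lam, (alpha <= F T u s0 lam) = (VaR T alpha u s0 <= lam).
Proof.
move=> /andP[a0 a1] uRH.
have [w Ew FE] := quantile_range (@total_cost R S A M T) (path_of_state s0)
  (fun w => law_ge0 s0 w uRH) (law_sum1 s0 uRH) a0 a1.
by exists w => //; rewrite /VaR Ew.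
Qed.

End CostDistribution.

(** * The improvement and optimality criteria *)

Theorem theorem10 (R : realType) (S A : finType) (M : mdp R S A)
    (T : nat) (T_ge1 : (1 <= T)%N)
    (alpha : R) (alpha_gt0 : 0 < alpha) (alpha_le1 : alpha <= 1)
    (u : policy M) (uDH : DH u) :
  (forall (s0 : S) (u' : policy M), DH u' ->
     alpha <= F T u' s0 (VaR_minus T alpha u s0) ->
     VaR T alpha u' s0 < VaR T alpha u s0)
  /\
  ((forall s0 : S,
      VaR T alpha u s0 = inf [set VaR T alpha v s0 | v in @RH R S A M])
   <->
   (forall s0 : S, Fstar M T s0 (VaR_minus T alpha u s0) < alpha)).
Proof.
have a01 : 0 < alpha <= 1 by rewrite alpha_gt0.
have uRH := DH_sub_RH uDH.
have better s0 (v : policy M) : RH v -> alpha <= F T v s0 (VaR_minus T alpha u s0) ->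
    VaR T alpha v s0 < VaR T alpha u s0.
  move=> vRH; have [_ _ ->] := VaR_range T s0 a01 vRH.
  move=> /le_lt_trans; apply; exact/left_pred_lt/(path_of_state M T s0).
split=> [s0 v vDH|]; first exact/better/DH_sub_RH.
split=> opt s0.
  apply/Fstar_lt => v vRH; rewrite ltNge; apply/negP => /(better _ _ vRH).
  apply/negP; rewrite -leNgt opt; apply: ge_inf; last by exists v.
  (* The least total cost bounds all the values at risk from below. *)
  have [w _ w_min] := min_of_range (@total_cost R S A M T) (path_of_state M T s0).
  exists (total_cost w) => _ [v' vRH' <-].
  by have [w' -> _] := VaR_range T s0 a01 vRH'.
have u_le (v : policy M) : RH v -> VaR T alpha u s0 <= VaR T alpha v s0.
  move=> vRH; rewrite leNgt; apply/negP.
  (* A smaller value for [v], being a total cost, would be at most the left predecessor, so [F] of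
     [v] would reach [alpha] there. *)
  have [w Ew FE] := VaR_range T s0 a01 vRH.
  rewrite Ew => /(le_left_pred (path_of_state M T s0)).
  rewrite -[leLHS]Ew -FE leNgt => /negP; apply.
  by have /Fstar_lt := opt s0; exact.
apply/eqP; rewrite eq_le; apply/andP; split.
  apply: lb_le_inf; first by exists (VaR T alpha u s0), u.
  by move=> _ [v vRH <-]; exact: u_le.
apply: ge_inf; last by exists u.
by exists (VaR T alpha u s0) => _ [v vRH <-]; exact: u_le.
Qed.
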